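(* There exists an absolute constant $\epsilon_0>0$ such that for any $0<\epsilon\le\epsilon_0$: any algorithm that has sample access to two unknown product distributions $P,Q$ over $\{0,1\}^n$ and distinguishes (with probability at least $2/3$) between the cases $P=Q$ and $\|P-Q\|_1>\epsilon$ requires $\Omega\big(\max(\sqrt n/\epsilon^2,\ n^{3/4}/\epsilon)\big)$ samples.
   Context: A product distribution over $\{0,1\}^n$ is one with independent coordinates. $\|P-Q\|_1=\sum_x|P(x)-Q(x)|$. A closeness tester must accept with probability at least $2/3$ when $P=Q$ and reject with probability at least $2/3$ when $\|P-Q\|_1>\epsilon$. *)

(* Defs.v *)
From HB Require Import structures.
From mathcomp Require Import all_boot all_order all_algebra.
From mathcomp Require Import interval_inference reals exp.

Set Implicit Arguments.
Unset Strict Implicit.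
Unset Printing Implicit Defensive.

Import Order.TTheory GRing.Theory Num.Theory.
Local Open Scope ring_scope.

Definition cube (n : nat) : finType := {ffun 'I_n -> bool}.

Section Distributions.
Variables (R : realType) (n : nat).
Implicit Types P Q : {ffun cube n -> R}.

Definition is_distribution P : Prop :=
  (forall x, 0 <= P x) /\ \sum_x P x = 1.

Definition marginal P (i : 'I_n) (b : bool) : R :=
  \sum_(x : cube n | x i == b) P x.

Definition is_product_distribution P : Prop :=
  is_distribution P /\ forall x : cube n, P x = \prod_(i < n) marginal P i (x i).

Definition l1_dist P Q : R := \sum_x `|P x - Q x|.

End Distributions.

(* A randomized algorithm with sample access to two distributions, as an
   adaptive decision tree: at each step it may halt with an answer ([true] means
   accept), toss a coin of arbitrary real bias, or draw a fresh sample from the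
   first or the second distribution and continue according to its value. *)
Inductive algorithm (R : realType) (n : nat) : Type :=
| Answer of bool
| Toss of {i01 R} & algorithm R n & algorithm R n
| SampleP of (cube n -> algorithm R n)
| SampleQ of (cube n -> algorithm R n).

Arguments Answer {R n}.

(* Largest total number of samples, from both distributions together, drawn in
   any run. *)
Fixpoint sample_complexity (R : realType) (n : nat) (A : algorithm R n) : nat :=
  match A with
  | Answer _ => 0
  | Toss _ A1 A2 => maxn (sample_complexity A1) (sample_complexity A2)
  | SampleP k | SampleQ k => (\max_x sample_complexity (k x)).+1
  end.

Fixpoint prob_answer (R : realType) (n : nat) (P Q : {ffun cube n -> R})
    (A : algorithm R n) (b : bool) : R :=
  match A with
  | Answer b' => (b' == b)%:R
  | Toss p A1 A2 =>
      p%:num * prob_answer P Q A1 b + (1 - p%:num) * prob_answer P Q A2 b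
  | SampleP k => \sum_x P x * prob_answer P Q (k x) b
  | SampleQ k => \sum_x Q x * prob_answer P Q (k x) b
  end.

Definition closeness_tester (R : realType) (n : nat) (eps : R)
    (A : algorithm R n) : Prop :=
  forall P Q : {ffun cube n -> R},
    is_product_distribution P -> is_product_distribution Q ->
    (P = Q -> 2 / 3 <= prob_answer P Q A true) /\
    (eps < l1_dist P Q -> 2 / 3 <= prob_answer P Q A false).

(* Main.v *)
Require Import Defs.
From mathcomp Require Import all_boot all_order all_algebra.
From mathcomp Require Import interval_inference reals exp.
From mathcomp Require Import ring lra.
Import Order.TTheory GRing.Theory Num.Theory.
Local Open Scope ring_scope.
Set Implicit Arguments.
Unset Strict Implicit.
Unset Printing Implicit Defensive.

(* An adaptive algorithm drawing at most m samples reads them off a tape holding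
   m samples of P and m samples of Q.  When the pairs of marginals (p_i, q_i) are
   drawn independently from a prior, the tape is a product over the coordinates
   of its columns, so the chi-square divergence between two such mixtures
   tensorizes and it suffices that its value for one column is at most a small
   constant over n.  Put l = 1/(4n) and e = 9 eps.

   For sqrt n / eps^2, compare (l, l) with (l, l (1 +- e)).  For n^(3/4) / eps, in
   the regime n eps^4 >= 1, compare (l, l) with (l (1 +- e), l (1 -+ e)), where
   moreover each coordinate is replaced with probability 1/10 by (h, h),
   h = 1/(m + 2): the heavy coordinates hide the collisions of the light ones, and
   the divergence of a column becomes of order (m l e)^4.  In both cases the
   differences of the light marginals add up to a constant times eps, which
   bounds the L1 distance from below because at most about one light coordinate
   is 1; by Markov's inequality half of the coordinates are light. *)

(** * Sums of products over finite function spaces *)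

Section ProductSums.
Variables (R : realType) (I : finType).

Lemma sum_ffun_prod (T : finType) (F : I -> T -> R) :
  \sum_(x : {ffun I -> T}) \prod_i F i (x i) = \prod_i \sum_b F i b.
Proof. by rewrite bigA_distr_bigA. Qed.

Lemma sum_ffun_prod_coord (T : finType) (F : I -> T -> R) (i : I)
    (g : T -> R) : (forall j, \sum_b F j b = 1) ->
  \sum_(x : {ffun I -> T}) (\prod_j F j (x j)) * g (x i) =
  \sum_b F i b * g b.
Proof.
move=> F1; transitivity (\prod_j \sum_b F j b * (if j == i then g b else 1)).
  rewrite -sum_ffun_prod; apply: eq_bigr => x _; rewrite big_split /=.
  congr (_ * _); rewrite (bigD1 i) //= eqxx big1 ?mulr1 // => j /negbTE -> //.
rewrite (bigD1 i) //= [X in _ * X]big1.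
  by rewrite mulr1; apply: eq_bigr => b _; rewrite eqxx.
by move=> j /negbTE ->; under eq_bigr do rewrite mulr1.
Qed.

Lemma sum_ffun_pair (A B : finType) (F : {ffun I -> A * B} -> R) :
  \sum_t F t = \sum_(a : {ffun I -> A}) \sum_(b : {ffun I -> B})
                 F [ffun i => (a i, b i)].
Proof.
rewrite pair_big /= (reindex (fun u : {ffun I -> A} * {ffun I -> B} =>
  [ffun i => (u.1 i, u.2 i)])) //=.
exists (fun t : {ffun I -> A * B} =>
  ([ffun i => (t i).1], [ffun i => (t i).2])) => [[a b] _|t _] /=.
  by congr pair; apply/ffunP => i; rewrite !ffunE.
by apply/ffunP => i; rewrite !ffunE; case: (t i).
Qed.

Lemma prod_one_sub_ge (P : pred I) (p : I -> R) :
  (forall i, P i -> 0 <= p i <= 1) ->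
  1 - \sum_(i | P i) p i <= \prod_(i | P i) (1 - p i).
Proof.
move=> p01.
suff [] : (0 <= \sum_(i | P i) p i) /\ 0 <= \prod_(i | P i) (1 - p i) <= 1 /\
  1 - \sum_(i | P i) p i <= \prod_(i | P i) (1 - p i) by move=> _ [].
(* The inequality alone is not inductive, so the invariant also bounds the running sum and the
   running product. *)
pose K (s t : R) := 0 <= s /\ 0 <= t <= 1 /\ 1 - s <= t.
apply: (big_rec2 K); rewrite /K; first by split; [|split]; lra.
move=> i y x /p01 pi [y0 [x01 xy]]; split; first lra.
by split; nra.
Qed.

End ProductSums.

(** * Bernoulli product laws and their L1 distance *)

Section BernoulliProducts.
Variable R : realType.

Definition bern (p : R) (b : bool) : R := if b then p else 1 - p.

Lemma sum_bern p : \sum_b bern p b = 1.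
Proof. by rewrite big_bool /= addrC subrK. Qed.

Lemma bern_ge0 p b : 0 <= p <= 1 -> 0 <= bern p b.
Proof. by case: b => /=; lra. Qed.

Lemma bern_gt0 p b : 0 < p < 1 -> 0 < bern p b.
Proof. by case: b => /=; lra. Qed.

Definition bern_prod n (p : 'I_n -> R) : {ffun cube n -> R} :=
  [ffun x : cube n => \prod_i bern (p i) (x i)].

Lemma expect_bern_prod n (p : 'I_n -> R) (phi : 'I_n -> bool -> R) :
  \sum_x bern_prod p x * \prod_i phi i (x i) =
  \prod_i (p i * phi i true + (1 - p i) * phi i false).
Proof.
transitivity (\prod_i \sum_b bern (p i) b * phi i b); last first.
  by apply: eq_bigr => i _; rewrite big_bool.
rewrite -sum_ffun_prod; apply: eq_bigr => x _.
by rewrite ffunE big_split.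
Qed.

Lemma sum_bern_prod n (p : 'I_n -> R) : \sum_x bern_prod p x = 1.
Proof.
under eq_bigr do rewrite ffunE.
rewrite (sum_ffun_prod (fun i => bern (p i))) big1 // => i _.
exact: sum_bern.
Qed.

Lemma bern_prod_is_product n (p : 'I_n -> R) : (forall i, 0 <= p i <= 1) ->
  is_product_distribution (bern_prod p).
Proof.
move=> p01; split; first split.
- by move=> x; rewrite ffunE prodr_ge0 // => i _; exact: bern_ge0.
- exact: sum_bern_prod.
move=> x; rewrite ffunE; apply: eq_bigr => i _; rewrite /marginal.
rewrite big_mkcond /=.
transitivity (\sum_(b : bool) bern (p i) b * (b == x i)%:R).
  by rewrite big_bool; case: (x i) => /=; rewrite ?mulr1 ?mulr0 ?addr0 ?add0r.
rewrite -(sum_ffun_prod_coord (F := fun j => bern (p j)) i); last first.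
  by move=> j; exact: sum_bern.
by apply: eq_bigr => y _; rewrite ffunE; case: eqP; rewrite ?mulr1 ?mulr0.
Qed.

(* The events "no coordinate of [G] is 1" and "i is the only coordinate of [G]
   that is 1" are disjoint; in terms of the odds o = p / (1 - p) their
   probabilities are Pi and o_i Pi, so the contribution of |Pi_p - Pi_q| to the
   latter events is paid for by the former. *)
Lemma l1_dist_bern_prod n (p q : 'I_n -> R) (G : {set 'I_n}) :
  (forall i, 0 <= p i < 1) -> (forall i, 0 <= q i < 1) ->
  \sum_(i in G) p i <= 1 / 2 -> \sum_(i in G) q i / (1 - q i) <= 1 ->
  1 / 2 * \sum_(i in G) `|p i - q i| <= l1_dist (bern_prod p) (bern_prod q).
Proof.
move=> p01 q01 sp sq.
(* [F0 x] and [F1 x i] are the indicators of the two kinds of event, written as products over the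
   coordinates so that [expect_bern_prod] evaluates their expectations. *)
pose f0 (j : 'I_n) (b : bool) : R := if j \in G then (~~ b)%:R else 1.
pose f1 (i j : 'I_n) (b : bool) : R := if j == i then b%:R else f0 j b.
pose F0 (x : cube n) := \prod_j f0 j (x j).
pose F1 (x : cube n) i := \prod_j f1 i j (x j).
have f0_01 j b : 0 <= f0 j b <= 1 by rewrite /f0; case: ifP; case: b => /=; lra.
have f1_01 i j b : 0 <= f1 i j b <= 1.
  by rewrite /f1; case: ifP => // _; case: b => /=; lra.
have F0_01 x : 0 <= F0 x <= 1.
  rewrite prodr_ge0 ?prodr_ile1 // => j _; by case/andP: (f0_01 j (x j)).
have F1_01 x i : 0 <= F1 x i <= 1.
  rewrite prodr_ge0 ?prodr_ile1 // => j _; by case/andP: (f1_01 i j (x j)).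
have F_le1 x : F0 x + \sum_(i in G) F1 x i <= 1.
  case: (pickP (fun i => (i \in G) && x i)) => [i /andP[iG xi]|noG].
    have -> : F0 x = 0 by rewrite /F0 (bigD1 i) //= /f0 iG xi mul0r.
    rewrite add0r (bigD1 i) //= big1 ?addr0; first by case/andP: (F1_01 x i).
    move=> k /andP[kG ki]; rewrite /F1 (bigD1 i) //= /f1 eq_sym (negbTE ki).
    by rewrite /f0 iG xi mul0r.
  rewrite big1 ?addr0; first by case/andP: (F0_01 x).
  move=> i iG; rewrite /F1 (bigD1 i) //= /f1 eqxx.
  by have := noG i; rewrite iG /= => ->; rewrite mul0r.
pose Pi (r : 'I_n -> R) := \prod_(j in G) (1 - r j).
have E0 r : \sum_x bern_prod r x * F0 x = Pi r.
  rewrite expect_bern_prod /Pi [RHS]big_mkcond; apply: eq_bigr => j _.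
  by rewrite /f0; case: ifP => _ /=; ring.
have E1 r i : i \in G -> (forall i, 0 <= r i < 1) ->
    \sum_x bern_prod r x * F1 x i = r i / (1 - r i) * Pi r.
  move=> iG r01; rewrite expect_bern_prod /Pi (bigD1 i) //=.
  rewrite [in RHS](bigD1 i) //=.
  rewrite /f1 eqxx mulr1 mulr0 addr0 mulrA divfK; last first.
    by have := r01 i; rewrite subr_eq0 => /andP[_ /gt_eqF ->].
  congr (_ * _); rewrite big_mkcond [RHS]big_mkcond; apply: eq_bigr => j _.
  rewrite andbC; case: eqP => //= _.
  by rewrite /f0; case: ifP => _ /=; ring.
have test (F : cube n -> R) : (forall x, 0 <= F x) ->
    `|\sum_x bern_prod p x * F x - \sum_x bern_prod q x * F x| <=
    \sum_x `|bern_prod p x - bern_prod q x| * F x.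
  move=> F_ge0; rewrite -sumrB; apply: le_trans (ler_norm_sum _ _ _) _.
  by apply: ler_sum => x _; rewrite -mulrBl normrM (ger0_norm (F_ge0 x)).
have Pp : 1 / 2 <= Pi p.
  apply: le_trans (prod_one_sub_ge _); first lra.
  by move=> i _; have := p01 i; lra.
have lb : `|Pi p - Pi q| + \sum_(i in G)
    `|p i / (1 - p i) * Pi p - q i / (1 - q i) * Pi q| <=
    l1_dist (bern_prod p) (bern_prod q).
  apply: (@le_trans _ _ (\sum_x `|bern_prod p x - bern_prod q x| *
      (F0 x + \sum_(i in G) F1 x i))); last first.
    by apply: ler_sum => x _; rewrite ler_piMr.
  under [leRHS]eq_bigr do rewrite mulrDr mulr_sumr.
  rewrite big_split /= exchange_big /= lerD //.
    by rewrite -!E0 test // => x; case/andP: (F0_01 x).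
  apply: ler_sum => i iG; rewrite -!E1 //.
  by apply: (test (F1 ^~ i)) => x; case/andP: (F1_01 x i).
apply: le_trans lb; set D := `|Pi p - Pi q|.
have D0 : 0 <= D by exact: normr_ge0.
(* The odds of [q] on [G] sum to at most 1, so the single [D] in front covers the losses of all
   coordinates. *)
apply: (@le_trans _ _ (D + \sum_(i in G)
  (1 / 2 * `|p i - q i| - q i / (1 - q i) * D))).
  by rewrite sumrB -mulr_suml -mulr_sumr; nra.
rewrite lerD2l; apply: ler_sum => i _.
have := p01 i; have := q01 i => qi pi.
have o0 : 0 <= q i / (1 - q i) by rewrite divr_ge0; lra.
(* The map x / (1 - x) has slope at least 1 on [0, 1). *)
have oD : `|p i - q i| <= `|p i / (1 - p i) - q i / (1 - q i)|.
  have -> : p i / (1 - p i) - q i / (1 - q i) =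
    (p i - q i) / ((1 - p i) * (1 - q i)) by field; apply/andP; split; lra.
  have ? : 0 < (1 - p i) * (1 - q i) by nra.
  rewrite normrM normfV (gtr0_norm (x := (1 - p i) * _)) // ler_pdivlMr //.
  by apply: ler_piMr => //; nra.
rewrite lerBlDr.
apply: (@le_trans _ _ `|(p i / (1 - p i) - q i / (1 - q i)) * Pi p|).
  rewrite normrM (ger0_norm (x := Pi p)); last lra.
  by have := normr_ge0 (p i - q i); nra.
have -> : (p i / (1 - p i) - q i / (1 - q i)) * Pi p =
  (p i / (1 - p i) * Pi p - q i / (1 - q i) * Pi q) -
  q i / (1 - q i) * (Pi p - Pi q) by ring.
by apply: le_trans (ler_normB _ _) _; rewrite normrM (ger0_norm o0) lexx.
Qed.

End BernoulliProducts.

(** * Tapes of samples and their laws, column by column *)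

Section Tapes.
Variable R : realType.

(* What [m] samples from each of [P] and [Q] show at a single coordinate. *)
Fixpoint column (m : nat) : finType :=
  if m is m'.+1 then (bool * bool * column m')%type else unit.

Fixpoint col_law (p q : R) (m : nat) : column m -> R :=
  match m with
  | 0 => fun _ => 1
  | m'.+1 => fun c => bern p c.1.1 * bern q c.1.2 * col_law p q c.2
  end.

Lemma sum_col_law p q m : \sum_(c : column m) col_law p q c = 1.
Proof.
elim: m => [|m IH]; first by rewrite (big_pred1 tt) // => -[].
rewrite -(pair_bigA _ (fun (x : bool * bool) (c : column m) =>
  bern p x.1 * bern q x.2 * col_law p q c)) /=.
under eq_bigr do rewrite -mulr_sumr IH mulr1.
rewrite -(pair_bigA _ (fun a b => bern p a * bern q b)) /=.
under eq_bigr do rewrite -mulr_sumr sum_bern mulr1.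
exact: sum_bern.
Qed.

Lemma col_law_ge0 p q m (c : column m) : 0 <= p <= 1 -> 0 <= q <= 1 ->
  0 <= col_law p q c.
Proof.
move=> p01 q01; elim: m c => //= m IH c.
by rewrite !mulr_ge0 ?bern_ge0.
Qed.

Lemma col_law_gt0 p q m (c : column m) : 0 < p < 1 -> 0 < q < 1 ->
  0 < col_law p q c.
Proof.
move=> p01 q01; elim: m c => //= m IH c.
by rewrite !mulr_gt0 ?bern_gt0.
Qed.

Lemma bern_inner (p p' h : R) : 0 < h < 1 ->
  \sum_b bern p b * bern p' b / bern h b =
  1 + (p - h) * (p' - h) / (h * (1 - h)).
Proof.
move=> h01; rewrite big_bool /=; field.
by apply/andP; split; apply/eqP; lra.
Qed.

(** The rows of a column are independent, so the inner product relative to [col_law h h] is a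
    product of one [bern_inner] factor per sample. Expanding the square in the chi-square divergence
    of a mixture yields exactly such terms. *)
Lemma col_law_inner (p q p' q' h : R) m : 0 < h < 1 ->
  \sum_(c : column m) col_law p q c * col_law p' q' c / col_law h h c =
  ((1 + (p - h) * (p' - h) / (h * (1 - h))) *
   (1 + (q - h) * (q' - h) / (h * (1 - h)))) ^+ m.
Proof.
move=> h01; elim: m => [|m IH].
  rewrite expr0 -(sum_col_law p q 0); apply: eq_bigr => c _ /=.
  by rewrite divr1 mulr1.
rewrite exprS -IH -!bern_inner // mulr_suml mulr_suml.
transitivity (\sum_(x : bool * bool) \sum_(c : column m)
  (bern p x.1 * bern p' x.1 / bern h x.1) *
  (bern q x.2 * bern q' x.2 / bern h x.2) *
  (col_law p q c * col_law p' q' c / col_law h h c)).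
  by rewrite pair_bigA; apply: eq_bigr => c _ /=; rewrite !invfM; ring.
rewrite -(pair_bigA _ (fun a b => \sum_(c : column m)
  (bern p a * bern p' a / bern h a) *
  (bern q b * bern q' b / bern h b) *
  (col_law p q c * col_law p' q' c / col_law h h c))) /=.
apply: eq_bigr => a _; rewrite -[RHS]mulrA mulr_suml mulr_sumr.
by apply: eq_bigr => b _; rewrite [RHS]mulrA mulr_sumr.
Qed.

Variable n : nat.

(* The probability, over the coin tosses only, of answering [b] when the samples
   are read off the tape [t]; [0] is a junk value for a tape that is too short. *)
Fixpoint run (b : bool) (A : algorithm R n) (m : nat) :
    {ffun 'I_n -> column m} -> R :=
  match A with
  | Answer b' => fun _ => (b' == b)%:R
  | Toss p A1 A2 => fun t => p%:num * run b A1 t + (1 - p%:num) * run b A2 t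
  | SampleP k => match m with
    | 0 => fun _ => 0
    | m'.+1 => fun t =>
        run b (k [ffun i => (t i).1.1]) [ffun i => (t i).2]
    end
  | SampleQ k => match m with
    | 0 => fun _ => 0
    | m'.+1 => fun t =>
        run b (k [ffun i => (t i).1.2]) [ffun i => (t i).2]
    end
  end.

Lemma run_01 b A m (t : {ffun 'I_n -> column m}) : 0 <= run b A t <= 1.
Proof.
elim: A m t => [b'|p A1 IH1 A2 IH2|k IH|k IH] m t /=.
- by case: (_ == _) => /=; lra.
- have p0 : 0 <= p%:num :> R by [].
  have p1 : p%:num <= 1 :> R by [].
  by have := IH1 _ t; have := IH2 _ t; nra.
- by case: m t => [|m] t; [lra|exact: IH].
- by case: m t => [|m] t; [lra|exact: IH].
Qed.

Lemma sum_tape_cons m (p q : 'I_n -> R)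
    (F : {ffun 'I_n -> bool * bool} -> {ffun 'I_n -> column m} -> R) :
  \sum_(t : {ffun 'I_n -> column m.+1}) (\prod_i col_law (p i) (q i) (t i)) *
    F [ffun i => (t i).1] [ffun i => (t i).2] =
  \sum_(x : cube n) bern_prod p x * (\sum_(y : cube n) bern_prod q y *
    \sum_(t : {ffun 'I_n -> column m}) (\prod_i col_law (p i) (q i) (t i)) *
      F [ffun i => (x i, y i)] t).
Proof.
rewrite (sum_ffun_pair (A := (bool * bool)%type) (B := column m)) sum_ffun_pair.
apply: eq_bigr => x _; rewrite mulr_sumr; apply: eq_bigr => y _.
rewrite !mulr_sumr; apply: eq_bigr => t _.
rewrite /bern_prod !ffunE !mulrA -!big_split /=; congr (_ * F _ _).
- by apply: eq_bigr => i _; rewrite !ffunE.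
- by apply/ffunP => i; rewrite !ffunE.
- by apply/ffunP => i; rewrite !ffunE.
Qed.

Lemma sum_tape_law m (p q : 'I_n -> R) :
  \sum_(t : {ffun 'I_n -> column m}) \prod_i col_law (p i) (q i) (t i) = 1.
Proof.
rewrite (sum_ffun_prod (fun i => col_law (p i) (q i) (m := m))) big1 // => i _.
exact: sum_col_law.
Qed.

(** Every draw consumes a whole row, whichever distribution it asks for, so [m] rows are enough for
    [m] draws in total. The sample of the other distribution in that row is never read and sums out
    to 1. *)
Lemma prob_answer_run b A m (p q : 'I_n -> R) : (sample_complexity A <= m)%N ->
  prob_answer (bern_prod p) (bern_prod q) A b =
  \sum_(t : {ffun 'I_n -> column m})
     (\prod_i col_law (p i) (q i) (t i)) * run b A t.
Proof.
elim: A m => [b'|r A1 IH1 A2 IH2|k IH|k IH] m /=.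
- by move=> _; rewrite -mulr_suml sum_tape_law mul1r.
- rewrite geq_max => /andP[m1 m2]; rewrite (IH1 m) // (IH2 m) //.
  rewrite !mulr_sumr -big_split /=; apply: eq_bigr => t _.
  by ring.
- case: m => // m; rewrite ltnS => /bigmax_leqP km.
  pose F (z : {ffun 'I_n -> bool * bool}) (t : {ffun 'I_n -> column m}) :=
    run b (k [ffun i => (z i).1]) t.
  transitivity (\sum_(t : {ffun 'I_n -> column m.+1})
    (\prod_i col_law (p i) (q i) (t i)) *
    F [ffun i => (t i).1] [ffun i => (t i).2]); last first.
    apply: eq_bigr => t _ /=; congr (_ * _).
    rewrite /F; apply: (congr1 (fun z => run b (k z) _)).
    by apply/ffunP => i; rewrite !ffunE.
  rewrite (sum_tape_cons p q F); apply: eq_bigr => x _.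
  congr (_ * _).
  rewrite -[LHS]mul1r -[X in X * _ = _](sum_bern_prod q) mulr_suml.
  apply: eq_bigr => y _; rewrite (IH x m) ?km //; congr (_ * _).
  have kE : [ffun i => ([ffun i => (x i, y i)] i).1] = x.
    by apply/ffunP => i; rewrite !ffunE.
  by apply: eq_bigr => t _; rewrite /F kE.
- case: m => // m; rewrite ltnS => /bigmax_leqP km.
  pose F (z : {ffun 'I_n -> bool * bool}) (t : {ffun 'I_n -> column m}) :=
    run b (k [ffun i => (z i).2]) t.
  transitivity (\sum_(t : {ffun 'I_n -> column m.+1})
    (\prod_i col_law (p i) (q i) (t i)) *
    F [ffun i => (t i).1] [ffun i => (t i).2]); last first.
    apply: eq_bigr => t _ /=; congr (_ * _).
    rewrite /F; apply: (congr1 (fun z => run b (k z) _)).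
    by apply/ffunP => i; rewrite !ffunE.
  rewrite (sum_tape_cons p q F).
  rewrite -[LHS]mul1r -[X in X * _ = _](sum_bern_prod p) mulr_suml.
  apply: eq_bigr => x _.
  congr (_ * _); apply: eq_bigr => y _.
  rewrite (IH y m) ?km //; congr (_ * _).
  have kE : [ffun i => ([ffun i => (x i, y i)] i).2] = y.
    by apply/ffunP => i; rewrite !ffunE.
  by apply: eq_bigr => t _; rewrite /F kE.
Qed.

Lemma prob_answer_ge0 b A (p q : 'I_n -> R) :
  (forall i, 0 <= p i <= 1) -> (forall i, 0 <= q i <= 1) ->
  0 <= prob_answer (bern_prod p) (bern_prod q) A b.
Proof.
move=> p01 q01; rewrite (prob_answer_run _ _ _ (leqnn _)) sumr_ge0 // => t _.
rewrite mulr_ge0 ?prodr_ge0 //; last by case/andP: (run_01 b A t).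
by move=> i _; exact: col_law_ge0.
Qed.

Lemma prob_answer_total A (P Q : {ffun cube n -> R}) :
  \sum_x P x = 1 -> \sum_x Q x = 1 ->
  prob_answer P Q A true + prob_answer P Q A false = 1.
Proof.
move=> P1 Q1; elim: A => [[]|r A1 IH1 A2 IH2|k IH|k IH] /=.
- by rewrite addr0.
- by rewrite add0r.
- by rewrite addrACA -!mulrDr IH1 IH2 !mulr1 addrC subrK.
- rewrite -big_split /= -[RHS]P1; apply: eq_bigr => x _.
  by rewrite -mulrDr IH mulr1.
- rewrite -big_split /= -[RHS]Q1; apply: eq_bigr => x _.
  by rewrite -mulrDr IH mulr1.
Qed.

End Tapes.

(** Controls the power (1 + chi)^n that comes from tensorizing over the [n] coordinates. *)
Lemma expr_one_add_le_linear (R : realType) (x : R) n :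
  0 <= x -> 2 * (n%:R * x) <= 1 -> (1 + x) ^+ n <= 1 + 2 * (n%:R * x).
Proof.
move=> x0; elim: n => [|n IH] nx; first by rewrite expr0 mul0r mulr0 addr0.
have n0 : 0 <= n%:R :> R by [].
rewrite -natr1 in nx *; rewrite exprSr.
have nx' : 2 * (n%:R * x) <= 1 by nra.
by have := IH nx'; nra.
Qed.

(** * Mixtures over a product prior: indistinguishability against the gap forced by a tester *)

Section Priors.
Variables (R : realType) (n : nat) (K : finType) (w : K -> R).
Hypotheses (w_ge0 : forall k, 0 <= w k) (w_sum1 : \sum_k w k = 1).

Definition mix_col (a : K -> R * R) m (c : column m) : R :=
  \sum_k w k * col_law (a k).1 (a k).2 c.

(* The marginals of the coordinates are drawn independently, the pair of
   marginals being [a k] with probability [w k]. *)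
Definition mix_prob (a : K -> R * R) (A : algorithm R n) (b : bool) : R :=
  \sum_(th : {ffun 'I_n -> K}) (\prod_i w (th i)) *
    prob_answer (bern_prod (fun i => (a (th i)).1))
                (bern_prod (fun i => (a (th i)).2)) A b.

Lemma sum_mix_col a m : \sum_(c : column m) mix_col a c = 1.
Proof.
rewrite exchange_big /= -[RHS]w_sum1; apply: eq_bigr => k _.
by rewrite -mulr_sumr sum_col_law mulr1.
Qed.

(** As the prior is independent over the coordinates, averaging the tape law over it leaves a
    product law, with [mix_col a] at each coordinate. This is what lets the chi-square divergence
    tensorize. *)
Lemma mix_prob_run a A b m : (sample_complexity A <= m)%N ->
  mix_prob a A b =
  \sum_(t : {ffun 'I_n -> column m}) (\prod_i mix_col a (t i)) * run b A t.
Proof.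
move=> Am; rewrite /mix_prob.
under eq_bigr do rewrite (prob_answer_run _ _ _ Am) mulr_sumr.
rewrite exchange_big /=; apply: eq_bigr => t _.
rewrite -(sum_ffun_prod (fun i k => w k * col_law (a k).1 (a k).2 (t i))).
rewrite mulr_suml; apply: eq_bigr => th _.
by rewrite big_split mulrA.
Qed.

Lemma sum_prior : \sum_(th : {ffun 'I_n -> K}) \prod_i w (th i) = 1.
Proof. by rewrite (sum_ffun_prod (fun=> w)) big1. Qed.

(* The chi-square divergence tensorizes over the coordinates, and
   (a - b) f <= b / 10 + 5 / 2 * (a - b)^2 / b for 0 <= f <= 1. *)
Lemma mix_prob_indistinguishable (a0 a1 : K -> R * R) A b m (chi : R) :
  (sample_complexity A <= m)%N ->
  (forall c : column m, 0 < mix_col a0 c) ->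
  \sum_(c : column m) mix_col a1 c ^+ 2 / mix_col a0 c <= 1 + chi ->
  0 <= chi -> n%:R * chi <= 1 / 100 ->
  mix_prob a1 A b - mix_prob a0 A b <= 3 / 20.
Proof.
move=> Am mu0 chiE chi0 nchi; rewrite !(mix_prob_run _ _ Am) -sumrB.
pose P0 (t : {ffun 'I_n -> column m}) := \prod_i mix_col a0 (t i).
pose P1 (t : {ffun 'I_n -> column m}) := \prod_i mix_col a1 (t i).
have P0_gt0 t : 0 < P0 t by apply: prodr_gt0.
have sP a : \sum_(t : {ffun 'I_n -> column m}) \prod_i mix_col a (t i) = 1.
  rewrite (sum_ffun_prod (fun=> mix_col a (m := m))) big1 // => i _.
  exact: sum_mix_col.
apply: (@le_trans _ _ (\sum_t (1 / 10 * P0 t +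
    5 / 2 * (P1 t ^+ 2 / P0 t - 2 * P1 t + P0 t)))).
  apply: ler_sum => t _; rewrite -mulrBl -/(P0 t) -/(P1 t).
  set f := run b A t; have f01 : 0 <= f <= 1 by exact: run_01.
  move: (P0 t) (P1 t) (P0_gt0 t) => u v u0.
  have -> : v ^+ 2 / u - 2 * v + u = (v - u) ^+ 2 / u.
    by field; apply/eqP; lra.
  set d := (v - u) ^+ 2 / u.
  have dE : d * u = (v - u) ^+ 2 by rewrite divfK ?gt_eqF.
  (* The right side minus the left is 5/2 ((v - u) - u f / 5)^2. *)
  have H : (v - u) * f * u <= (1 / 10 * (u * f ^+ 2) + 5 / 2 * d) * u.
    rewrite [leRHS](_ : _ = 1 / 10 * (u * f) ^+ 2 + 5 / 2 * (d * u)); last by ring.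
    by rewrite dE; have := sqr_ge0 ((v - u) - (u * f) / 5); lra.
  rewrite ler_pM2r // in H; apply: le_trans H _; rewrite lerD2r.
  have f2 : f ^+ 2 <= 1 by nra.
  by nra.
rewrite big_split /= -!mulr_sumr big_split /= sumrB -mulr_sumr !sP.
have -> : \sum_t P1 t ^+ 2 / P0 t =
    (\sum_(c : column m) mix_col a1 c ^+ 2 / mix_col a0 c) ^+ n.
  rewrite -[n in RHS]card_ord -prodr_const.
  rewrite -(sum_ffun_prod (fun _ c => mix_col a1 c ^+ 2 / mix_col a0 c)).
  by apply: eq_bigr => t _; rewrite /P1 /P0 big_split /= prodrXl prodfV.
set S := \sum_c _ in chiE *.
have S0 : 0 <= S.
  by apply: sumr_ge0 => c _; rewrite divr_ge0 ?sqr_ge0 // ltW.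
(* Hence S^n - 1 <= 2 n chi <= 1/50, and the total is at most 1/10 + 5/2 * 1/50 = 3/20. *)
have : S ^+ n <= (1 + chi) ^+ n by apply: lerXn2r => //; rewrite nnegrE; lra.
have := @expr_one_add_le_linear _ chi n chi0.
by lra.
Qed.

(** On the null side P = Q always, so rejection has probability at most 1/3. On the alternative side
    it has probability at least 8/15, by Markov's inequality for the number of bad coordinates. The
    gap 1/5 exceeds the 3/20 of [mix_prob_indistinguishable]. *)
Lemma mix_prob_gap (eps : R) A (a0 a1 : K -> R * R) (bad : pred K) :
  closeness_tester eps A -> (0 < n)%N ->
  (forall k, 0 <= (a0 k).1 <= 1) -> (forall k, (a0 k).2 = (a0 k).1) ->
  (forall k, 0 <= (a1 k).1 <= 1) -> (forall k, 0 <= (a1 k).2 <= 1) ->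
  \sum_(k | bad k) w k <= 1 / 10 ->
  (forall th : {ffun 'I_n -> K}, (2 * #|[set i | bad (th i)]| <= n)%N ->
     eps < l1_dist (bern_prod (fun i => (a1 (th i)).1))
                   (bern_prod (fun i => (a1 (th i)).2))) ->
  1 / 5 <= mix_prob a1 A false - mix_prob a0 A false.
Proof.
move=> tA n0 a0_01 a0E a1_01 a1_01' wbad far.
have prior_ge0 (th : {ffun 'I_n -> K}) : 0 <= \prod_i w (th i).
  by apply: prodr_ge0.
have up : mix_prob a0 A false <= 1 / 3.
  rewrite -[leRHS]mul1r -[X in _ <= X * _]sum_prior mulr_suml.
  apply: ler_sum => th _.
  rewrite ler_wpM2l //.
  set P := bern_prod (fun i => (a0 (th i)).1).
  have -> : bern_prod (fun i => (a0 (th i)).2) = P.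
    by apply/ffunP => x; rewrite !ffunE; apply: eq_bigr => i _; rewrite a0E.
  have PP : is_product_distribution P by apply: bern_prod_is_product.
  have [/(_ erefl) acc _] := tA P P PP PP.
  have := @prob_answer_total _ _ A P P (sum_bern_prod _) (sum_bern_prod _).
  by lra.
suff : 8 / 15 <= mix_prob a1 A false by lra.
have nR : 0 < n%:R :> R by rewrite ltr0n.
(* Markov's inequality in linear form: 2/3 - 4/3 (number of bad coordinates) / n is at most 2/3, and
   is negative once more than half of them are bad. Its mean is at least 2/3 - 4/3 * 1/10 = 8/15. *)
apply: (@le_trans _ _ (\sum_(th : {ffun 'I_n -> K}) (\prod_i w (th i)) *
  (2 / 3 - \sum_(i < n) 4 / 3 / n%:R * (bad (th i))%:R))).
  under eq_bigr do rewrite mulrBr.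
  rewrite sumrB -mulr_suml sum_prior mul1r.
  under [X in _ - X]eq_bigr do rewrite mulr_sumr.
  rewrite exchange_big /=.
  under [X in _ - X]eq_bigr => i _.
    rewrite (sum_ffun_prod_coord (F := fun=> w) i
      (fun k => 4 / 3 / n%:R * (bad k)%:R)) //.
    under eq_bigr do rewrite mulrCA.
    rewrite -mulr_sumr.
    over.
  rewrite sumr_const card_ord.
  have -> : \sum_k w k * (bad k)%:R = \sum_(k | bad k) w k.
    rewrite [RHS]big_mkcond; apply: eq_bigr => k _.
    by case: (bad k); rewrite ?mulr1 ?mulr0.
  move: wbad; set s := \sum_(k | _) _ => wbad; 
  rewrite -[_ * s *+ _]mulr_natr.
  have -> : 4 / 3 / n%:R * s * n%:R = 4 / 3 * s by field; rewrite gt_eqF.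
  by lra.
apply: ler_sum => th _; rewrite ler_wpM2l //.
have [good|notgood] := boolP (2 * #|[set i | bad (th i)]| <= n)%N.
  have [_ /(_ (far th good))] := tA _ _
    (bern_prod_is_product (fun i => a1_01 (th i)))
    (bern_prod_is_product (fun i => a1_01' (th i))).
  move=> rej; apply: le_trans rej; rewrite lerBlDr lerDl.
  apply: sumr_ge0 => i _.
  by rewrite mulr_ge0 // divr_ge0.
apply: (@le_trans _ _ 0); last by apply: prob_answer_ge0.
rewrite -mulr_sumr -natr_sum -ltnNge in notgood *.
have -> : (\sum_(i < n) bad (th i) = #|[set i | bad (th i)]|)%N.
  by rewrite -sum1dep_card [RHS]big_mkcond.
move: notgood; rewrite -(ltr_nat R) natrM => notgood.
rewrite subr_le0 mulrAC ler_pdivlMr //.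
by lra.
Qed.

End Priors.

(** * Elementary bounds on powers *)

Section PowerBounds.
Variable R : realType.

(** The linear coefficient is exact, so that first-order terms can cancel when several such bounds
    are combined. *)
Lemma expr_one_add_le_quadratic (x : R) n : -1 <= x -> n%:R * x <= 1 ->
  (1 + x) ^+ n <= 1 + n%:R * x + (n%:R * x) ^+ 2.
Proof.
move=> x1; elim: n => [|n IH] nx.
  by rewrite expr0 mul0r expr0n /= !addr0.
have n0 : 0 <= n%:R :> R by [].
rewrite -natr1 in nx *; rewrite exprSr.
have nx' : n%:R * x <= 1 by nra.
have x1' : 0 <= 1 + x by lra.
apply: le_trans (ler_wpM2r x1' (IH nx')) _.
rewrite -subr_ge0.
have -> : 1 + (n%:R + 1) * x + ((n%:R + 1) * x) ^+ 2 -
  (1 + n%:R * x + (n%:R * x) ^+ 2) * (1 + x) =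
  x ^+ 2 * (1 + n%:R * (1 - n%:R * x)) by ring.
by rewrite mulr_ge0 ?sqr_ge0 // addr_ge0 // mulr_ge0 // subr_ge0.
Qed.

Lemma expr_one_add_ge_linear (x : R) n : -1 <= x ->
  1 + n%:R * x <= (1 + x) ^+ n.
Proof.
move=> x1; elim: n => [|n IH]; first by rewrite expr0 mul0r addr0.
have n0 : 0 <= n%:R :> R by [].
rewrite -natr1 exprSr.
have x1' : 0 <= 1 + x by lra.
apply: le_trans (ler_wpM2r x1' IH).
by have := mulr_ge0 n0 (sqr_ge0 x); lra.
Qed.

(* The terms of first order in [al] cancel. *)
Lemma second_difference_bound (W al : R) m :
  1 <= W -> W <= 2 -> m%:R * (W - 1) <= 1 ->
  0 <= al -> al <= 1 -> 3 * (m%:R * al) <= 1 ->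
  1 / 2 * ((W + al) ^+ 2 - 4 * ((W - 1) * al)) ^+ m +
  1 / 2 * ((W - al) ^+ 2) ^+ m - 2 * (W ^+ 2 - (W - 1) * al) ^+ m +
  (W ^+ 2) ^+ m <= 130 * (m%:R * al) ^+ 2.
Proof.
move=> W1 W2 mW al0 al1 mal.
set V := W ^+ 2; have V1 : 1 <= V by rewrite /V; nra.
have V0 : V != 0 by rewrite gt_eqF //; lra.
set i := V^-1.
have i0 : 0 < i by rewrite invr_gt0; lra.
have i1 : i <= 1 by rewrite invf_le1; lra.
have Vi : V * i = 1 by rewrite divff.
have m0 : 0 <= m%:R :> R by [].
(* The relative changes of [V] in the three bases. After factoring out [V ^+ m], the powers of 1 + x
   and 1 + y need upper bounds, while that of 1 + z enters negatively and needs Bernoulli's lower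
   bound. *)
pose x := ((4 - 2 * W) * al + al ^+ 2) * i.
pose y := (al ^+ 2 - 2 * W * al) * i.
pose z := (al - W * al) * i.
have xE : (W + al) ^+ 2 - 4 * ((W - 1) * al) = V * (1 + x).
  have -> : V * (1 + x) = V + ((4 - 2 * W) * al + al ^+ 2) * (V * i).
    by rewrite /x; ring.
  by rewrite Vi /V; ring.
have yE : (W - al) ^+ 2 = V * (1 + y).
  have -> : V * (1 + y) = V + (al ^+ 2 - 2 * W * al) * (V * i).
    by rewrite /y; ring.
  by rewrite Vi /V; ring.
have zE : V - (W - 1) * al = V * (1 + z).
  have -> : V * (1 + z) = V + (al - W * al) * (V * i) by rewrite /z; ring.
  by rewrite Vi; ring.
have x0 : 0 <= x by rewrite mulr_ge0 ?(ltW i0) //; nra.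
have x3 : x <= 3 * al.
  have : (4 - 2 * W) * al + al ^+ 2 <= 3 * al by nra.
  move=> H; apply: le_trans (_ : 3 * al * i <= _); last by nra.
  by rewrite ler_wpM2r // ltW.
have y0 : y <= 0 by rewrite mulr_le0_ge0 ?(ltW i0) //; nra.
have y1 : -1 <= y.
  have : 0 <= V * (1 + y) by rewrite -yE sqr_ge0.
  by rewrite pmulr_rge0; lra.
have y4 : -4 * al <= y.
  have : -4 * al <= al ^+ 2 - 2 * W * al by nra.
  move=> H; apply: le_trans (_ : -4 * al * i <= _); first by nra.
  by rewrite ler_wpM2r // ltW.
have z1 : -1 <= z.
  have : 0 <= V * (1 + z) by rewrite -zE; nra.
  by rewrite pmulr_rge0; lra.
rewrite xE yE zE !(exprMn _ V).
have -> : 1 / 2 * (V ^+ m * (1 + x) ^+ m) + 1 / 2 * (V ^+ m * (1 + y) ^+ m) -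
    2 * (V ^+ m * (1 + z) ^+ m) + V ^+ m =
  V ^+ m * (1 / 2 * (1 + x) ^+ m + 1 / 2 * (1 + y) ^+ m -
    2 * (1 + z) ^+ m + 1) by ring.
have Vm0 : 0 <= V ^+ m by rewrite exprn_ge0 //; lra.
have Vm9 : V ^+ m <= 9.
  rewrite /V exprAC.
  have W3 : W ^+ m <= 3.
    have := @expr_one_add_le_quadratic (W - 1) m.
    have -> : 1 + (W - 1) = W by ring.
    move=> /(_ _ mW) H; apply: le_trans (H _) _; first lra.
    have : 0 <= m%:R * (W - 1) by nra.
    by nra.
  have W0 : 0 <= W ^+ m by rewrite exprn_ge0 //; lra.
  by nra.
have bx : (1 + x) ^+ m <= 1 + m%:R * x + (m%:R * x) ^+ 2.
  by apply: expr_one_add_le_quadratic; [lra|nra].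
have by_ : (1 + y) ^+ m <= 1 + m%:R * y + (m%:R * y) ^+ 2.
  by apply: expr_one_add_le_quadratic; [lra|nra].
have bz := @expr_one_add_ge_linear z m z1.
(* Half of this is the total first-order contribution; only a term in [al ^+ 2] survives. *)
have xyz : m%:R * x + m%:R * y - 4 * (m%:R * z) = 2 * (m%:R * al ^+ 2 * i).
  by rewrite /x /y /z; ring.
have mm : m%:R * al ^+ 2 * i <= (m%:R * al) ^+ 2.
  apply: (@le_trans _ _ (m%:R * al ^+ 2)).
    by rewrite ler_piMr // mulr_ge0 ?sqr_ge0.
  rewrite exprMn ler_wpM2r ?sqr_ge0 //.
  by case: (m) => [|k]; rewrite ?expr0n // -natrX ler_nat -mulnn leq_pmulr.
have mx2 : (m%:R * x) ^+ 2 <= 9 * (m%:R * al) ^+ 2.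
  have H1 : 0 <= m%:R * x by rewrite mulr_ge0.
  have H2 : m%:R * x <= 3 * (m%:R * al) by nra.
  by nra.
have my2 : (m%:R * y) ^+ 2 <= 16 * (m%:R * al) ^+ 2.
  have H1 : m%:R * y <= 0 by rewrite mulr_ge0_le0.
  have H2 : -4 * (m%:R * al) <= m%:R * y by nra.
  by nra.
set T := (m%:R * al) ^+ 2 in mm mx2 my2 *.
(* 27/2 = 1 + 9/2 + 16/2, from [mm], [mx2] and [my2]; multiplied by the bound 9 on [V ^+ m] it stays
   below 130. *)
apply: (@le_trans _ _ (V ^+ m * (27 / 2 * T))).
  by rewrite ler_wpM2l //; lra.
have T0 : 0 <= T by exact: sqr_ge0.
by nra.
Qed.

End PowerBounds.

(** * The hard priors and the chi-square divergence of one column *)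

Section HardInstances.
Variable R : realType.

Definition sgb (b : bool) : R := if b then 1 else -1.

(** Marginals of at most 1/(2n) sum to at most 1/2, and each of their odds is at most 1/n, which is
    what [l1_dist_bern_prod] requires. *)
Lemma l1_dist_light n (p q : 'I_n -> R) (G : {set 'I_n}) (s : R) :
  (0 < n)%N -> (forall i, 0 <= p i < 1) -> (forall i, 0 <= q i < 1) ->
  (forall i, i \in G -> p i <= 1 / 2 / n%:R) ->
  (forall i, i \in G -> q i <= 1 / 2 / n%:R) ->
  (forall i, i \in G -> `|p i - q i| = s) ->
  1 / 2 * (#|G|%:R * s) <= l1_dist (bern_prod p) (bern_prod q).
Proof.
move=> n0 p01 q01 pG qG pqG; have nR : 1 <= n%:R :> R by rewrite ler1n.
have Gn (F : 'I_n -> R) (b : R) : 0 <= b -> (forall i, i \in G -> F i <= b) ->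
    \sum_(i in G) F i <= n%:R * b.
  move=> b0 Fb; apply: le_trans (ler_sum _ Fb) _.
  rewrite sumr_const -[leLHS]mulr_natl ler_wpM2r // ler_nat.
  by rewrite -[leqRHS]card_ord max_card.
have -> : #|G|%:R * s = \sum_(i in G) `|p i - q i|.
  by rewrite (eq_bigr _ pqG) sumr_const mulr_natl.
have n_neq0 : n%:R != 0 :> R by rewrite gt_eqF //; lra.
have half_le : 1 / 2 / n%:R <= 1 / 2 :> R.
  by rewrite ler_pdivrMr; lra.
have half_ge : 0 <= 1 / 2 / n%:R :> R by rewrite !divr_ge0 //; lra.
apply: l1_dist_bern_prod => //.
  apply: le_trans (Gn _ _ half_ge pG) _.
  by rewrite mulrC divfK.
rewrite -[leRHS](divff n_neq0); apply: Gn; first by rewrite invr_ge0; lra.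
move=> i iG; have := q01 i; have qi := qG i iG => qi01.
rewrite ler_pdivrMr; last lra.
apply: le_trans qi _; rewrite mulrC ler_wpM2l ?invr_ge0 //.
by have := qG i iG; lra.
Qed.

Lemma sum_option_bool (F : option bool -> R) :
  \sum_k F k = F None + F (Some true) + F (Some false).
Proof.
rewrite (bigD1 None) //= (bigD1 (Some true)) //= (bigD1 (Some false)) //=.
rewrite big1 ?addr0 ?addrA //.
by case=> [[]|].
Qed.

(* [one]: every coordinate is light and only [Q] is perturbed.  [two]: a
   coordinate is heavy ([None]) with probability 1/10, and otherwise light.  The
   boolean is the uniform sign of the perturbation of relative size [e]. *)
Definition null_one (l : R) (b : bool) : R * R := (l, l).
Definition alt_one (l e : R) (b : bool) : R * R := (l, l * (1 + sgb b * e)).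

(** Two signs b, b' have correlation (1 + b b' y)^m. Averaging over the four pairs gives ((1 + y)^m
    + (1 - y)^m) / 2, where the linear terms cancel. *)
Lemma chi2_one_sided (l e y : R) m : 0 < l < 1 ->
  y = l * e ^+ 2 / (1 - l) -> 0 <= y <= 1 -> m%:R * y <= 1 ->
  \sum_(c : column m) mix_col (fun=> 1 / 2) (alt_one l e) c ^+ 2 /
    mix_col (fun=> 1 / 2) (null_one l) c <= 1 + (m%:R * y) ^+ 2.
Proof.
move=> l01 yE y01 my.
have inner b b' : \sum_(c : column m)
    col_law l (l * (1 + sgb b * e)) c * col_law l (l * (1 + sgb b' * e)) c /
    col_law l l c = (1 + sgb b * sgb b' * y) ^+ m.
  rewrite col_law_inner // yE; congr (_ ^+ _); field.
  by apply/andP; split; apply/eqP; lra.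
rewrite (eq_bigr (fun c : column m => \sum_b \sum_b' 1 / 4 *
    (col_law l (l * (1 + sgb b * e)) c * col_law l (l * (1 + sgb b' * e)) c /
     col_law l l c))); last first.
  move=> c _; rewrite /mix_col !big_bool /=.
  have -> : 1 / 2 * col_law l l c + 1 / 2 * col_law l l c = col_law l l c.
    by field.
  by field; rewrite gt_eqF // col_law_gt0.
rewrite exchange_big /=.
rewrite (eq_bigr (fun b => \sum_b' 1 / 4 * (1 + sgb b * sgb b' * y) ^+ m)).
  rewrite !big_bool /=.
  have -> : 1 + 1 * 1 * y = 1 + y by ring.
  have -> : 1 + 1 * -1 * y = 1 - y by ring.
  have -> : 1 + -1 * 1 * y = 1 - y by ring.
  have -> : 1 + -1 * -1 * y = 1 + y by ring.
  have m0 : 0 <= m%:R :> R by [].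
  have H1 : (1 + y) ^+ m <= 1 + m%:R * y + (m%:R * y) ^+ 2.
    by apply: expr_one_add_le_quadratic => //; lra.
  have H2 : (1 - y) ^+ m <= 1 + m%:R * - y + (m%:R * - y) ^+ 2.
    by apply: expr_one_add_le_quadratic; [lra | nra].
  by rewrite mulrN sqrrN in H2; lra.
move=> b _; rewrite exchange_big /=; apply: eq_bigr => b' _.
by rewrite -mulr_sumr inner.
Qed.

Definition weight_two (k : option bool) : R :=
  if k is Some _ then 9 / 20 else 1 / 10.
Definition null_two (h l : R) (k : option bool) : R * R :=
  if k is Some _ then (l, l) else (h, h).
Definition alt_two (h l e : R) (k : option bool) : R * R :=
  if k is Some b then (l * (1 + sgb b * e), l * (1 - sgb b * e)) else (h, h).

(* The difference of the two mixtures is supported on the light coordinates, but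
   the heavy component alone bounds the denominator from below. *)
Lemma chi2_two_sided (h l e W al : R) m : 0 < h < 1 -> 0 < l < 1 ->
  W = 1 + (h - l) ^+ 2 / (h * (1 - h)) -> al = (l * e) ^+ 2 / (h * (1 - h)) ->
  1 <= W -> W <= 2 -> m%:R * (W - 1) <= 1 ->
  0 <= al -> al <= 1 -> 3 * (m%:R * al) <= 1 ->
  \sum_(c : column m) mix_col weight_two (alt_two h l e) c ^+ 2 /
    mix_col weight_two (null_two h l) c <= 1 + 1053 * (m%:R * al) ^+ 2.
Proof.
move=> h01 l01 WE alE W1 W2 mW al0 al1 mal.
pose H (c : column m) := col_law h h c.
pose L (c : column m) := col_law l l c.
pose P (c : column m) := col_law (l * (1 + 1 * e)) (l * (1 - 1 * e)) c.
pose M (c : column m) := col_law (l * (1 + -1 * e)) (l * (1 - -1 * e)) c.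
(* With u the null mixture and d = (P + M) / 2 - L, the alternative is u + 9/10 d. Since u >= H /
   10, the quadratic part is at most 81/10 d^2 / H. The linear part sums to 1, and 1053 = 81/10 *
   130 with the constant of [second_difference_bound]. *)
apply: (@le_trans _ _ (\sum_(c : column m) (1 / 10 * H c +
  9 / 20 * P c + 9 / 20 * M c + (9 / 20 * P c + 9 / 20 * M c - 9 / 10 * L c) +
  81 / 10 * (1 / 4 * (P c * P c / H c) + 1 / 4 * (M c * M c / H c) +
   1 / 2 * (P c * M c / H c) + -1 * (P c * L c / H c) +
   -1 * (M c * L c / H c) + L c * L c / H c)))).
  apply: ler_sum => c _; rewrite /mix_col !sum_option_bool /=.
  rewrite -/(H c) -/(L c) -/(P c) -/(M c).
  have H0 : 0 < H c by exact: col_law_gt0.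
  have L0 : 0 < L c by exact: col_law_gt0.
  move: (H c) (L c) (P c) (M c) H0 L0 => h' l' p' m' h0 l0.
  pose u := 1 / 10 * h' + 9 / 10 * l'.
  pose d := 1 / 2 * p' + 1 / 2 * m' - l'.
  have u0 : 0 < u by rewrite /u; lra.
  have -> : 1 / 10 * h' + 9 / 20 * l' + 9 / 20 * l' = u by rewrite /u; field.
  have -> : 1 / 10 * h' + 9 / 20 * p' + 9 / 20 * m' = u + 9 / 10 * d.
    by rewrite /u /d; field.
  have -> : (u + 9 / 10 * d) ^+ 2 / u = u + 9 / 5 * d + 81 / 100 * (d ^+ 2 / u).
    by field; rewrite gt_eqF.
  have -> : 1 / 4 * (p' * p' / h') + 1 / 4 * (m' * m' / h') +
    1 / 2 * (p' * m' / h') + -1 * (p' * l' / h') + -1 * (m' * l' / h') +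
    l' * l' / h' = d ^+ 2 / h' by rewrite /d; field; rewrite gt_eqF.
  have : d ^+ 2 / u <= d ^+ 2 / (1 / 10 * h').
    rewrite ler_wpM2l ?sqr_ge0 // lef_pV2 ?posrE // /u; lra.
  have -> : d ^+ 2 / (1 / 10 * h') = 10 * (d ^+ 2 / h').
    by field; rewrite gt_eqF.
  have : 9 / 10 * d = 9 / 20 * p' + 9 / 20 * m' - 9 / 10 * l'.
    by rewrite /d; field.
  by lra.
rewrite !big_split /= sumrN -!mulr_sumr !big_split /= -!mulr_sumr !sum_col_law.
rewrite !col_law_inner //.
set k := (h * (1 - h))^-1.
have EP : (1 + (l * (1 + 1 * e) - h) * (l * (1 + 1 * e) - h) * k) *
   (1 + (l * (1 - 1 * e) - h) * (l * (1 - 1 * e) - h) * k) =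
  (W + al) ^+ 2 - 4 * ((W - 1) * al) by rewrite WE alE -/k; ring.
have EM : (1 + (l * (1 + -1 * e) - h) * (l * (1 + -1 * e) - h) * k) *
   (1 + (l * (1 - -1 * e) - h) * (l * (1 - -1 * e) - h) * k) =
  (W + al) ^+ 2 - 4 * ((W - 1) * al) by rewrite WE alE -/k; ring.
have EPM : (1 + (l * (1 + 1 * e) - h) * (l * (1 + -1 * e) - h) * k) *
   (1 + (l * (1 - 1 * e) - h) * (l * (1 - -1 * e) - h) * k) =
  (W - al) ^+ 2 by rewrite WE alE -/k; ring.
have EPL : (1 + (l * (1 + 1 * e) - h) * (l - h) * k) *
   (1 + (l * (1 - 1 * e) - h) * (l - h) * k) =
  W ^+ 2 - (W - 1) * al by rewrite WE alE -/k; ring.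
have EML : (1 + (l * (1 + -1 * e) - h) * (l - h) * k) *
   (1 + (l * (1 - -1 * e) - h) * (l - h) * k) =
  W ^+ 2 - (W - 1) * al by rewrite WE alE -/k; ring.
have EL : (1 + (l - h) * (l - h) * k) * (1 + (l - h) * (l - h) * k) = W ^+ 2.
  by rewrite WE -/k; ring.
rewrite EP EM EPM EPL EML EL.
by have := second_difference_bound W1 W2 mW al0 al1 mal; lra.
Qed.

End HardInstances.

(** * Sample lower bounds from the two constructions, in root-free form *)

Lemma light_bounds (R : realType) n (l e : R) : (0 < n)%N ->
  n%:R * l = 1 / 4 -> 0 < e <= 1 ->
  [/\ 1 / 2 / n%:R = 2 * l, 0 < l <= 1 / 4, 0 < l * e <= l &
      forall b, 0 <= l * (1 + sgb R b * e) <= 2 * l].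
Proof.
move=> n_gt0 nl e01; have n1 : 1 <= n%:R :> R by rewrite ler1n.
have n_neq0 : n%:R != 0 :> R by rewrite gt_eqF // ltr0n.
have l0 : 0 < l by rewrite -(pmulr_rgt0 l (lt_le_trans ltr01 n1)) nl; lra.
have le1 : 0 < l * e <= l by nra.
split => // [||b].
- by apply: (mulfI n_neq0); rewrite [RHS]mulrCA nl; field.
- by rewrite l0 -nl ler_peMl // ltW.
- by case: b => /=; lra.
Qed.

(** The square of m > sqrt n / (10^3 eps^2). If it failed, n chi would be at most 729 / 10^6, making
    the two mixtures too close for a tester. *)
Lemma one_sided_lower_bound (R : realType) n (eps : R) (A : algorithm R n) :
  (0 < n)%N -> 0 < eps -> eps <= 1 / 9 -> closeness_tester eps A ->
  n%:R / 10 ^+ 6 < (sample_complexity A)%:R ^+ 2 * eps ^+ 4.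
Proof.
move=> n_gt0 eps_gt0 eps_le testA.
have nR : 1 <= n%:R :> R by rewrite ler1n.
have n_neq0 : n%:R != 0 :> R by rewrite gt_eqF // ltr0n.
have [l nl] : exists l : R, n%:R * l = 1 / 4.
  by exists (n%:R^-1 * (1 / 4)); rewrite mulVKf.
have [e eE] : exists e, e = 9 * eps by exists (9 * eps).
have e01 : 0 < e <= 1 by lra.
have [l2 lb le1 light_range] := light_bounds n_gt0 nl e01.
set m := sample_complexity A; rewrite ltNge; apply/negP => mn.
pose y := l * e ^+ 2 / (1 - l).
(* Here n l e^2 = 81/4 eps^2, and 1 / (1 - l) <= 4/3 because l <= 1/4. *)
have yn : y * n%:R <= 27 * eps ^+ 2.
  rewrite /y mulrAC ler_pdivrMr; last lra.
  have -> : l * e ^+ 2 * n%:R = n%:R * l * e ^+ 2 by ring.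
  by rewrite nl eE; have := sqr_ge0 eps; nra.
have y0 : 0 <= y by rewrite divr_ge0 ?mulr_ge0 ?sqr_ge0 //; lra.
have chi_le : n%:R * (m%:R * y) ^+ 2 <= 1 / 100.
  have n0 : 0 < n%:R :> R by lra.
  rewrite -(ler_pM2r n0).
  have -> : n%:R * (m%:R * y) ^+ 2 * n%:R = m%:R ^+ 2 * (y * n%:R) ^+ 2 by ring.
  apply: (@le_trans _ _ (m%:R ^+ 2 * (27 * eps ^+ 2) ^+ 2)).
    have yn0 : 0 <= y * n%:R by rewrite mulr_ge0.
    by rewrite ler_wpM2l ?sqr_ge0 // lerXn2r // nnegrE; apply: le_trans yn.
  have -> : m%:R ^+ 2 * (27 * eps ^+ 2) ^+ 2 = 729 * (m%:R ^+ 2 * eps ^+ 4) by ring.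
  by lra.
have my1 : m%:R * y <= 1.
  have : (m%:R * y) ^+ 2 <= n%:R * (m%:R * y) ^+ 2 by rewrite ler_peMl ?sqr_ge0.
  by nra.
have y1 : y <= 1 by have := sqr_ge0 eps; nra.
have l01 : 0 < l < 1 by lra.
have chi2 := @chi2_one_sided R l e y m l01 erefl (introT andP (conj y0 y1)) my1.
have w1 : \sum_(b : bool) 1 / 2 = 1 :> R by rewrite big_bool /=; lra.
have w0 : 0 <= 1 / 2 :> R by lra.
have up := mix_prob_indistinguishable w1 false (leqnn _) _ chi2 (sqr_ge0 _) chi_le.
have {}up : mix_prob (fun=> 1 / 2) (alt_one l e) A false -
    mix_prob (fun=> 1 / 2) (null_one l) A false <= 3 / 20.
  apply: up => c; rewrite /mix_col big_bool /=.
  by rewrite addr_gt0 // mulr_gt0 ?divr_gt0 ?col_law_gt0.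
suff : 1 / 5 <= mix_prob (fun=> 1 / 2) (alt_one l e) A false -
    mix_prob (fun=> 1 / 2) (null_one l) A false by lra.
apply: (@mix_prob_gap R n bool _ (fun=> w0) w1 eps A _ _ pred0) => //=.
- by move=> _; lra.
- by move=> _; lra.
- by move=> b; have := light_range b; lra.
- by rewrite big_pred0 //; lra.
(* The factor 9 in [e] makes this bound 1/2 * n l e = 9/8 eps, just above [eps]. *)
move=> th _; apply: (@lt_le_trans _ _ (1 / 2 * (#|[set: 'I_n]|%:R * (l * e)))).
  by rewrite cardsT card_ord mulrA nl eE; lra.
apply: l1_dist_light => //= i.
- by lra.
- by have := light_range (th i); lra.
- by rewrite l2; lra.
- by rewrite l2; have := light_range (th i); lra.
have -> : l - l * (1 + sgb R (th i) * e) = - (sgb R (th i) * (l * e)) by ring.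
rewrite normrN normrM [X in _ * X]ger0_norm; last lra.
by case: (th i) => /=; rewrite ?normrN normr1 mul1r.
Qed.

(** The bad values of the prior are the heavy ones. When at least half of the coordinates are light,
    the L1 distance is at least 1/2 * n/2 * 2 l e = 9/8 eps. *)
Lemma chi2_two_sided_large (R : realType) n (eps : R) (A : algorithm R n)
    (l e h chi : R) :
  (0 < n)%N -> 0 < eps -> closeness_tester eps A ->
  n%:R * l = 1 / 4 -> e = 9 * eps -> e <= 1 -> 0 < h < 1 -> 0 <= chi ->
  \sum_(c : column (sample_complexity A))
    mix_col (weight_two R) (alt_two h l e) c ^+ 2 /
    mix_col (weight_two R) (null_two h l) c <= 1 + chi ->
  1 / 100 < n%:R * chi.
Proof.
move=> n_gt0 eps_gt0 testA nl eE e1 h01 chi0 chi2.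
have e01 : 0 < e <= 1 by lra.
have [l2 lb le1 light_range] := light_bounds n_gt0 nl e01.
have l01 : 0 < l < 1 by lra.
rewrite ltNge; apply/negP => chi_le.
have w1 : \sum_k weight_two R k = 1 by rewrite sum_option_bool /=; lra.
have w0 k : 0 <= weight_two R k by case: k => [?|] /=; lra.
have up := mix_prob_indistinguishable w1 false (leqnn _) _ chi2 chi0 chi_le.
have {}up : mix_prob (weight_two R) (alt_two h l e) A false -
    mix_prob (weight_two R) (null_two h l) A false <= 3 / 20.
  apply: up => c; rewrite /mix_col sum_option_bool /=.
  by rewrite !addr_gt0 // mulr_gt0 ?divr_gt0 ?col_law_gt0.
suff : 1 / 5 <= mix_prob (weight_two R) (alt_two h l e) A false -
    mix_prob (weight_two R) (null_two h l) A false by lra.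
have light_range' b : 0 <= l * (1 - sgb R b * e) <= 2 * l.
  by have := light_range (~~ b); case: b => /=; rewrite ?mulN1r ?mul1r ?opprK.
apply: (@mix_prob_gap R n _ _ w0 w1 eps A _ _ (pred1 None)) => //=.
- by case=> [?|] /=; lra.
- by case.
- by case=> [b|] /=; [have := light_range b|]; lra.
- by case=> [b|] /=; [have := light_range' b|]; lra.
- by rewrite big_pred1_eq /=; lra.
move=> th few; pose G := [set i | th i != None].
have Gn : n%:R <= 2 * #|G|%:R :> R.
  have GC : ~: G = [set i | th i == None].
    by apply/setP => i; rewrite !inE negbK.
  have := cardsC G; rewrite GC card_ord => Gn.
  rewrite -natrM ler_nat; move: few Gn.
  move: #|G| #|[set i | th i == None]| => a b /[swap] <-.
  by rewrite !mul2n -!addnn leq_add2r leq_add2l.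
apply: (@lt_le_trans _ _ (1 / 2 * (#|G|%:R * (2 * (l * e))))).
  have : n%:R * (l * e) <= 2 * #|G|%:R * (l * e) by rewrite ler_pM2r //; lra.
  by rewrite mulrA nl eE; lra.
apply: l1_dist_light => //= i.
- by case: (th i) => [b|] /=; [have := light_range b|]; lra.
- by case: (th i) => [b|] /=; [have := light_range' b|]; lra.
- by rewrite inE l2; case: (th i) => //= b _; have := light_range b; lra.
- by rewrite inE l2; case: (th i) => //= b _; have := light_range' b; lra.
rewrite inE; case: (th i) => //= b _.
have -> : l * (1 + sgb R b * e) - l * (1 - sgb R b * e) =
  sgb R b * (2 * (l * e)) by ring.
rewrite normrM [X in _ * X]ger0_norm; last lra.
by case: b => /=; rewrite ?normrN normr1 mul1r.
Qed.

Lemma two_sided_lower_bound (R : realType) n (eps : R) (A : algorithm R n) :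
  (0 < n)%N -> 0 < eps -> eps <= 1 / 9 -> 1 <= n%:R * eps ^+ 4 ->
  closeness_tester eps A ->
  n%:R ^+ 3 / 10 ^+ 12 < (sample_complexity A)%:R ^+ 4 * eps ^+ 4.
Proof.
move=> n_gt0 eps_gt0 eps_le neps testA.
have nR : 1 <= n%:R :> R by rewrite ler1n.
have n_gt0R : 0 < n%:R :> R by rewrite ltr0n.
have n_neq0 : n%:R != 0 :> R by rewrite gt_eqF.
have [l nl] : exists l : R, n%:R * l = 1 / 4.
  by exists (n%:R^-1 * (1 / 4)); rewrite mulVKf.
have [e eE] : exists e, e = 9 * eps by exists (9 * eps).
have e01 : 0 < e <= 1 by lra.
have [l2 lb le1 light_range] := light_bounds n_gt0 nl e01.
rewrite ltNge; apply/negP => mn.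
pose N : R := (sample_complexity A)%:R; rewrite -/N in mn.
have N0 : 0 <= N by rewrite /N.
have le_of_expr4 (a b : R) : 0 <= a -> 0 <= b -> a ^+ 4 <= b ^+ 4 -> a <= b.
  by move=> a0 b0; rewrite ler_pXn2r.
have n34 : n%:R ^+ 3 <= n%:R ^+ 4 :> R by rewrite exprS ler_peMl // exprn_ge0.
have Neps : N * eps <= n%:R / 10 ^+ 3.
  apply: le_of_expr4; [by rewrite mulr_ge0 // ltW|by rewrite divr_ge0|].
  have -> : (n%:R / 10 ^+ 3) ^+ 4 = n%:R ^+ 4 / 10 ^+ 12 :> R by field.
  by rewrite exprMn; lra.
(* The regime n eps^4 >= 1 enters here. It keeps the number of samples below [n], so that the heavy
   marginal [h] is at least [l]. *)
have Nn : N <= n%:R / 10 ^+ 3.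
  apply: le_of_expr4 => //.
  have -> : (n%:R / 10 ^+ 3) ^+ 4 = n%:R * (n%:R ^+ 3 / 10 ^+ 12) :> R by field.
  apply: (@le_trans _ _ (n%:R * (N ^+ 4 * eps ^+ 4))).
    by rewrite mulrCA ler_peMr // exprn_ge0.
  by rewrite ler_pM2l.
move: mn {neps}.
have N1 : 0 < N + 1 by lra.
have N2 : 0 < N + 2 by lra.
have [h hE] : exists h, h * (N + 2) = 1 by exists (N + 2)^-1; rewrite mulVf ?gt_eqF.
have h0 : 0 < h by rewrite -(pmulr_lgt0 h N2) hE.
have hN : h * (N + 1) = 1 - h by lra.
have h1 : h < 1 by have := mulr_gt0 h0 N1; lra.
have lh : l <= h.
  rewrite -(ler_pM2r N2) hE.
  have : l * (N + 2) <= l * (4 * n%:R) by rewrite ler_pM2l //; lra.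
  have -> : l * (4 * n%:R) = 4 * (n%:R * l) by ring.
  by rewrite nl; lra.
have h_neq0 : h != 0 by rewrite gt_eqF.
have h1_neq0 : 1 - h != 0 by rewrite gt_eqF // subr_gt0.
(* By the choice of [h], 1 - h = h (N + 1), so the left side is (d / h)^2. It is applied to d = h -
   l and to d = l e. *)
have sq_le (d : R) : 0 <= d -> d <= h -> d ^+ 2 / (h * (1 - h)) * (N + 1) <= 1.
  move=> d0 dh.
  have -> : d ^+ 2 / (h * (1 - h)) * (N + 1) =
    d ^+ 2 * (h * (N + 1)) / (h ^+ 2 * (1 - h)).
    by field; apply/andP.
  rewrite hN -mulf_div divff // mulr1 ler_pdivrMr ?exprn_gt0 // mul1r.
  by rewrite lerXn2r // nnegrE ltW.
have [W WE] : exists W, W = 1 + (h - l) ^+ 2 / (h * (1 - h)) by eexists.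
have [al alE] : exists al, al = (l * e) ^+ 2 / (h * (1 - h)) by eexists.
have k0 : 0 < h * (1 - h) by rewrite mulr_gt0 // subr_gt0.
have W1 : 1 <= W by rewrite WE lerDl divr_ge0 ?sqr_ge0 // ltW.
have WN : (W - 1) * (N + 1) <= 1.
  by rewrite WE addrAC subrr add0r; apply: sq_le; lra.
have al0 : 0 <= al by rewrite alE divr_ge0 ?sqr_ge0 // ltW.
have alN : al * (N + 1) <= 1 by rewrite alE; apply: sq_le; lra.
have W2 : W <= 2 by nra.
have mW : N * (W - 1) <= 1 by nra.
have al1 : al <= 1 by nra.
have Nal : N * al <= 5 * (N * (l * e)) ^+ 2.
  have alE' : al * (N + 1) = (l * e) ^+ 2 * (N + 2) ^+ 2.
    have -> : al * (N + 1) = (l * e) ^+ 2 * (h * (N + 1)) / (h ^+ 2 * (1 - h)).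
      by rewrite alE; field; apply/andP.
    have -> : N + 2 = h^-1 by apply: (mulfI h_neq0); rewrite hE divff.
    by rewrite hN; field; apply/andP.
  rewrite -(ler_pM2r N1) -mulrA alE'.
  have -> : N * ((l * e) ^+ 2 * (N + 2) ^+ 2) =
    (l * e) ^+ 2 * (N * (N + 2) ^+ 2) by ring.
  have -> : 5 * (N * (l * e)) ^+ 2 * (N + 1) =
    (l * e) ^+ 2 * (5 * N ^+ 2 * (N + 1)) by ring.
  rewrite ler_wpM2l ?sqr_ge0 //.
  (* The constant 5 comes from (N + 2)^2 <= 5 N (N + 1), which reads 9 <= 10 at N = 1 and fails at N
     = 0. *)
  have [->|N_ge1] : N = 0 \/ 1 <= N.
    rewrite /N; case: (sample_complexity A) => [|k]; [by left|right].
    by rewrite ler1n.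
  - by rewrite !mul0r expr0n mulr0 mul0r.
  have -> : 5 * N ^+ 2 * (N + 1) = N * (5 * N * (N + 1)) by ring.
  by rewrite ler_wpM2l //; nra.
have Nle : N * (l * e) <= 9 / 4000.
  rewrite -(ler_pM2l n_gt0R).
  have -> : n%:R * (N * (l * e)) = n%:R * l * 9 * (N * eps) by rewrite eE; ring.
  by rewrite nl; lra.
have Nle0 : 0 <= N * (l * e) by rewrite mulr_ge0 //; lra.
have mal : 3 * (N * al) <= 1 by nra.
have h01 : 0 < h < 1 by rewrite h0.
have l01 : 0 < l < 1 by lra.
have chi2 := chi2_two_sided h01 l01 WE alE W1 W2 mW al0 al1 mal.
have [chi chiE] : exists chi, chi = 1053 * (N * al) ^+ 2 by eexists.
have chi0 : 0 <= chi.
  by rewrite chiE; apply: mulr_ge0; [exact: ler0n|exact: sqr_ge0].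
rewrite -/N -chiE in chi2; have /andP[_ e1] := e01 => mn.
have := chi2_two_sided_large n_gt0 eps_gt0 testA nl eE e1 h01 chi0 chi2.
rewrite chiE ltNge => /negP[].
(* Multiplied by n^3, the quantity n chi is bounded by a constant times (n l)^4 N^4 eps^4, to which
   the assumed upper bound on N^4 eps^4 applies. *)
rewrite -(ler_pM2l (exprn_gt0 3 n_gt0R)).
have Nal0 : 0 <= N * al by rewrite mulr_ge0.
have -> : n%:R ^+ 3 * (n%:R * (1053 * (N * al) ^+ 2)) =
  1053 * (n%:R ^+ 4 * (N * al) ^+ 2) by ring.
have : n%:R ^+ 4 * (N * al) ^+ 2 <=
    n%:R ^+ 4 * (5 * (N * (l * e)) ^+ 2) ^+ 2.
  rewrite ler_wpM2l ?exprn_ge0 // lerXn2r // nnegrE.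
  by apply: le_trans Nal.
have -> : n%:R ^+ 4 * (5 * (N * (l * e)) ^+ 2) ^+ 2 =
  25 * 9 ^+ 4 * (n%:R * l) ^+ 4 * (N ^+ 4 * eps ^+ 4) by rewrite eE; ring.
by rewrite nl; have := exprn_ge0 3 (ltW n_gt0R); lra.
Qed.

Theorem theorem4p25 (R : realType) :
  exists eps0 c : R, 0 < eps0 /\ 0 < c /\
    forall (n : nat) (eps : R), 0 < eps -> eps <= eps0 ->
    forall A : algorithm R n, closeness_tester eps A ->
      c * Num.max (Num.sqrt n%:R / eps ^+ 2) (n%:R `^ (3 / 4) / eps)
        <= (sample_complexity A)%:R.
Proof.
(* The bound 1/9 ensures 9 eps <= 1, so perturbed marginals stay nonnegative; 10^3 is both the
   square root of 10^6 and the fourth root of 10^12. *)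
exists (1 / 9), (1 / 10 ^+ 3); split; [lra|split; first lra].
move=> n eps eps0 eps9 A testA.
set N := (sample_complexity A)%:R; have N0 : 0 <= N by rewrite /N.
have [n0|n_gt0] := posnP n.
  have q_neq0 : 3 / 4 != 0 :> R by apply/eqP; lra.
  by rewrite n0 sqrtr0 mul0r powR0 // mul0r maxxx mulr0.
have nR : 0 < n%:R :> R by rewrite ltr0n.
set s := Num.sqrt n%:R; set r := n%:R `^ (3 / 4).
have s0 : 0 <= s by exact: sqrtr_ge0.
have r0 : 0 <= r by exact: powR_ge0.
have sE : s ^+ 2 = n%:R by rewrite sqr_sqrtr // ltW.
have rE : r ^+ 4 = n%:R ^+ 3.
  by rewrite -!powR_mulrn ?powR_ge0 ?ltW // -powRrM; congr (_ `^ _); field.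
have eps_ge0 := ltW eps0.
have e2 : 0 < eps ^+ 2 by rewrite exprn_gt0.
have one : 1 / 10 ^+ 3 * (s / eps ^+ 2) <= N.
  have := one_sided_lower_bound n_gt0 eps0 eps9 testA.
  rewrite -/N => H; rewrite mulrA ler_pdivrMr //.
  rewrite -(@ler_pXn2r _ 2) ?nnegrE ?mulr_ge0 ?divr_ge0 ?exprn_ge0 //.
  rewrite exprMn sE.
  have -> : (N * eps ^+ 2) ^+ 2 = N ^+ 2 * eps ^+ 4 by ring.
  by lra.
(* If n^(3/4) / eps is strictly the larger term, then sqrt n < n^(3/4) eps. Its fourth power gives n
   eps^4 > 1, the regime of [two_sided_lower_bound]. *)
have [//|lt] := leP (r / eps) (s / eps ^+ 2).
have neps : 1 <= n%:R * eps ^+ 4.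
  have : s < r * eps.
    move: lt; rewrite ltr_pdivrMr //.
    by have -> : r / eps * eps ^+ 2 = r * eps by field; rewrite gt_eqF.
  rewrite -(@ltr_pXn2r _ 4) ?nnegrE ?mulr_ge0 // exprMn rE.
  have -> : s ^+ 4 = n%:R ^+ 2 by rewrite -sE; ring.
  rewrite [_ ^+ 3]exprSr -mulrA -[ltLHS]mulr1 ltr_pM2l ?exprn_gt0 // => /ltW //.
have := two_sided_lower_bound n_gt0 eps0 eps9 neps testA.
rewrite -/N => H; rewrite mulrA ler_pdivrMr //.
rewrite -(@ler_pXn2r _ 4) ?nnegrE ?mulr_ge0 ?divr_ge0 ?exprn_ge0 //.
by rewrite !exprMn rE; lra.
Qed.
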